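(* Let $\mathcal V=\{V;\nu_1,\dots,\nu_n\}$ be a vector arrangement over $\Bbbk$ with associated hyperplane arrangement $\mathcal H=\{V;H_1,\dots,H_n\}$. Then the graded Euler characteristic of the characteristic homology equals the characteristic polynomial: $$\chi_q(H_d^\bullet(\mathcal H,\Bbbk))=\chi(\mathcal H,q).$$
   Context: Let $\Bbbk$ be a field of characteristic zero. A vector arrangement $\mathcal V=\{V;\nu_1,\dots,\nu_n\}$ is a finite-dimensional $\Bbbk$-vector space $V$ with an inner product $\langle-,-\rangle$ together with a list of vectors $\nu_i\in V$ (zero vectors allowed). The associated hyperplane arrangement is $\mathcal H=\{V;H_1,\dots,H_n\}$ with $H_i=\nu_i^\perp$ (so $H_i=V$ if $\nu_i=0$). Put $[n]=\{1,\dots,n\}$ and, for $S\subseteq[n]$, $H_S=\bigcap_{s\in S}H_s$ (with $H_\emptyset=V$). The inner product is understood to restrict non-degenerately to all subspaces onto which orthogonal projections are taken. Characteristic polynomial: $\chi(\mathcal H,q)=\sum_{S\subseteq[n]}(-1)^{|S|}(1+q)^{\dim H_S}$. Chain complex $C_d^\bullet(\mathcal H,\Bbbk)$: $C^i=\bigoplus_{|S|=i}\bigwedge^\bullet H_S$, with bigrading $\deg\bigwedge^jH_S=(|S|,j)$, the first degree being homological. For $r\notin S$ let $d_{S,r}:\bigwedge^\bullet H_S\to\bigwedge^\bullet H_{S\cup r}$ be induced by the orthogonal projection $H_S\to H_{S\cup r}$, and let $\varepsilon_{S,r}=-1$ if $|\{s\in S: s<r\}|$ is odd and $+1$ otherwise.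 The differential is $d^i=\bigoplus_{|S|=i,\,r\notin S}\varepsilon_{S,r}d_{S,r}:C^i\to C^{i+1}$. Its homology is the characteristic homology $H_d^\bullet(\mathcal H,\Bbbk)$, bigraded as $H_d^{i,j}$. Graded Euler characteristic: $\chi_q(H_d^\bullet)=\sum_{i,j}(-1)^i q^j\dim H_d^{i,j}$. *)

(* Defs.v *)
From HB Require Import structures.
From mathcomp Require Import all_boot all_order all_fingroup all_algebra.

Set Implicit Arguments.
Unset Strict Implicit.
Unset Printing Implicit Defensive.

Import GRing.Theory.
Local Open Scope ring_scope.

Section AlternatingMaps.

Variables (K : fieldType) (W F : vectType K) (j : nat).
Implicit Types (f : {ffun 'I_j -> W} -> F) (w : {ffun 'I_j -> W}).

Definition subst_ffun w (i : 'I_j) (u : W) : {ffun 'I_j -> W} :=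
  [ffun k => if k == i then u else w k].

Definition multilinear f : Prop :=
  forall w i (a : K) (u v : W),
    f (subst_ffun w i (a *: u + v)) =
    a *: f (subst_ffun w i u) + f (subst_ffun w i v).

Definition alternating f : Prop :=
  forall w (i k : 'I_j), i != k -> w i = w k -> f w = 0.

Lemma multilinear_sum f w i (I : finType) (a : I -> K) (u : I -> W) :
  multilinear f ->
  f (subst_ffun w i (\sum_x a x *: u x)) =
  \sum_x a x *: f (subst_ffun w i (u x)).
Proof.
move=> fL.
have f0: f (subst_ffun w i 0) = 0.
  by have:= fL w i (-1) 0 0; rewrite scaleN1r oppr0 addr0 scaleN1r addNr.
elim/big_rec2: _ => // x y v _ <-.
by rewrite fL.
Qed.

Lemma alternating_tperm f w (i k : 'I_j) : multilinear f -> alternating f ->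
  i != k -> f [ffun l => w (tperm i k l)] = - f w.
Proof.
move=> fL fA neq_ik; pose g u v := f (subst_ffun (subst_ffun w i u) k v).
have gC u v : subst_ffun (subst_ffun w i u) k v
            = subst_ffun (subst_ffun w k v) i u.
  apply/ffunP=> l; rewrite !ffunE.
  by case: (l =P k) => [->|//]; rewrite eq_sym (negPf neq_ik).
have gDr u v v' : g u (v + v') = g u v + g u v'.
  by have:= fL (subst_ffun w i u) k 1 v v'; rewrite !scale1r.
have gDl u u' v : g (u + u') v = g u v + g u' v.
  by rewrite /g !gC; have:= fL (subst_ffun w k v) i 1 u u'; rewrite !scale1r.
have g0 u : g u u = 0.
  by apply: (fA _ i k neq_ik); rewrite !ffunE (negPf neq_ik) !eqxx.
have -> : f w = g (w i) (w k).
  by congr f; apply/ffunP=> l; rewrite !ffunE; do 2?case: eqP => [->|_].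
have -> : f [ffun l => w (tperm i k l)] = g (w k) (w i).
  congr f; apply/ffunP=> l; rewrite !ffunE.
  case: (l =P k) => [->|/eqP nk]; first by rewrite tpermR.
  case: (l =P i) => [->|/eqP ni]; first by rewrite tpermL.
  by rewrite tpermD // eq_sym.
apply/eqP; rewrite -addr_eq0.
by have:= g0 (w k + w i); rewrite gDl !gDr !g0 add0r addr0 => ->.
Qed.

Lemma alternating_perm0 f w (s : 'S_j) : multilinear f -> alternating f ->
  f w = 0 -> f [ffun l => w (s l)] = 0.
Proof.
move=> fL fA fw; case: (prod_tpermP s) => ts -> {s}.
elim: ts w fw => [|[i k] ts IHts] w fw /= h.
  by rewrite big_nil (_ : [ffun _ => _] = w) //; apply/ffunP=> l; rewrite ffunE perm1.
move: h => /andP[/= neq_ik h]; rewrite big_cons /=.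
pose w' := [ffun l => w ((\prod_(t <- ts) tperm t.1 t.2)%g l)].
have -> : [ffun l => w ((tperm i k * \prod_(t <- ts) tperm t.1 t.2)%g l)]
        = [ffun l => w' (tperm i k l)].
  by apply/ffunP=> l; rewrite !ffunE permM.
by rewrite alternating_tperm // /w' IHts ?oppr0.
Qed.

End AlternatingMaps.

Section ExteriorPower.

Variable K : fieldType.
Implicit Types W F : vectType K.

Definition stdvec W (k : 'I_(\dim {:W})) : W := (vbasis {:W})`_k.

Definition coordinate W (k : 'I_(\dim {:W})) (u : W) : K :=
  coord (vbasis {:W}) k u.

Definition extpow_index W j := {A : {set 'I_(\dim {:W})} | #|A| == j}.

Definition index_nth W j (A : extpow_index W j) (k : 'I_j) : 'I_(\dim {:W}) :=
  enum_val (cast_ord (esym (eqP (valP A))) k).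

(* The j-th exterior power of W, by its coordinates on the basis              *)
(* e_(a_0) /\ ... /\ e_(a_(j-1)), a_0 < ... < a_(j-1), where (e_k) is the     *)
(* basis stdvec of W. The coordinates of w_0 /\ ... /\ w_(j-1) are the        *)
(* maximal minors of the matrix whose rows are the coordinates of the w_i.    *)
(* That this is the exterior power (universal property) is wedge_universal.   *)
Definition extpow W j : vectType K := {ffun extpow_index W j -> K^o}.

Definition wedge W j (w : {ffun 'I_j -> W}) : extpow W j :=
  [ffun A => \det (\matrix_(i < j, k < j) coordinate (index_nth A k) (w i))].

Definition stdwedge W j (A : extpow_index W j) : {ffun 'I_j -> W} :=
  [ffun k => stdvec (index_nth A k)].

(* The induced map, given on the basis; functoriality is extmap_wedge.        *)
Definition extmap W W' j (f : 'Hom(W, W')) : 'Hom(extpow W j, extpow W' j) :=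
  linfun (fun x : extpow W j =>
    \sum_A (x A : K) *: wedge [ffun k => f (stdwedge A k)]).

Lemma vecE W (u : W) : u = \sum_k coordinate k u *: stdvec k.
Proof. by rewrite [LHS](coord_vbasis (memvf u)). Qed.

Lemma coordinateP W (k : 'I_(\dim {:W})) a (u v : W) :
  coordinate k (a *: u + v) = a * coordinate k u + coordinate k v.
Proof. by rewrite /coordinate linearP. Qed.

Lemma coordinate_std W (i k : 'I_(\dim {:W})) :
  coordinate k (stdvec i) = (i == k)%:R.
Proof. by rewrite /coordinate coord_free // (basis_free (vbasisP _)). Qed.

Lemma index_nth_inj W j (A : extpow_index W j) : injective (@index_nth W j A).
Proof. by move=> i k /enum_val_inj /cast_ord_inj. Qed.

Lemma mem_index_nth W j (A : extpow_index W j) k : index_nth A k \in val A.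
Proof. exact: enum_valP. Qed.

Lemma index_nth_onto W j (A : extpow_index W j) x :
  x \in val A -> exists k, index_nth A k = x.
Proof.
move=> Ax; exists (cast_ord (eqP (valP A)) (enum_rank_in Ax x)).
by rewrite /index_nth cast_ordK enum_rankK_in.
Qed.

Lemma wedge_multilinear W j : multilinear (@wedge W j).
Proof.
move=> w i a u v; apply/ffunP=> A; rewrite !ffunE.
rewrite -[X in _ = _ + X]mul1r.
apply: (determinant_multilinear (i0 := i)).
- by apply/rowP=> k; rewrite !mxE !ffunE eqxx coordinateP mul1r.
- by apply/matrixP=> l k; rewrite !mxE !ffunE eq_sym (negPf (neq_lift _ _)).
- by apply/matrixP=> l k; rewrite !mxE !ffunE eq_sym (negPf (neq_lift _ _)).
Qed.

Lemma wedge_alternating W j : alternating (@wedge W j).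
Proof.
move=> w i k neq_ik eq_w; apply/ffunP=> A; rewrite !ffunE.
by apply: (determinant_alternate neq_ik) => l; rewrite !mxE eq_w.
Qed.

Lemma wedge_std W j (A B : extpow_index W j) :
  wedge (stdwedge A) B = (A == B)%:R.
Proof.
rewrite ffunE; have [->|neqAB] := eqVneq A B.
  rewrite (_ : \matrix_(_, _) _ = 1%:M) ?det1 //.
  apply/matrixP=> i k; rewrite !mxE !ffunE coordinate_std.
  by rewrite (inj_eq (@index_nth_inj _ _ B)).
have [x Ax nBx] : exists2 x, x \in val A & x \notin val B.
  apply/subsetPn; apply: contra neqAB => sAB; apply/eqP/val_inj/eqP.
  by rewrite eqEcard sAB (eqP (valP A)) (eqP (valP B)) leqnn.
have [i Di] := index_nth_onto Ax.
rewrite (expand_det_row _ i) big1 // => k _; rewrite !mxE !ffunE coordinate_std Di.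
case: eqP => [/= Dx|_]; last by rewrite mul0r.
by case/negP: nBx; rewrite Dx mem_index_nth.
Qed.

Lemma extpowE W j (x : extpow W j) :
  x = \sum_A (x A : K) *: wedge (stdwedge A).
Proof.
apply/ffunP=> B; rewrite sum_ffunE (bigD1 B) //= big1 => [|A neqAB].
  by rewrite addr0 ffunE wedge_std eqxx [_ *: _]mulr1.
by rewrite ffunE wedge_std (negPf neqAB) scaler0.
Qed.

Lemma alternating_eq0 W F j (f : {ffun 'I_j -> W} -> F) :
    multilinear f -> alternating f ->
  (forall A : extpow_index W j, f (stdwedge A) = 0) -> forall w, f w = 0.
Proof.
move=> fL fA f0 w.
suff f_le m : (m <= j)%N -> forall w : {ffun 'I_j -> W},
    (forall i : 'I_j, (m <= i)%N -> exists k, w i = stdvec k) -> f w = 0.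
  by apply: (f_le j) => // i; rewrite leqNgt ltn_ord.
elim: m => [_ {}w wP|m IHm lt_mj {}w wP]; last first.
  pose i := Ordinal lt_mj.
  have -> : w = subst_ffun w i (\sum_k coordinate k (w i) *: stdvec k).
    by apply/ffunP=> l; rewrite ffunE -vecE; case: eqP => [->|].
  rewrite multilinear_sum // big1 // => k _.
  rewrite IHm ?scaler0 1?ltnW // => l le_ml; rewrite ffunE.
  case: eqP => [_|/eqP nli]; first by exists k.
  by apply: wP; rewrite ltn_neqAle le_ml eq_sym -val_eqE /= andbT in nli *.
have /fin_all_exists[h Dw] i : exists k, w i = stdvec k by apply: wP.
have [/injectiveP h_inj|/injectivePn[i [k neq_ik eq_h]]] := boolP (injectiveb h).
  have cA : #|[set h i | i : 'I_j]| == j by rewrite card_imset // card_ord.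
  pose A : extpow_index W j := Sub [set h i | i : 'I_j] cA.
  have /fin_all_exists[s Ds] i : exists k, index_nth A k = h i.
    by apply: index_nth_onto; apply: imset_f.
  have s_inj : injective s by move=> i k eq_s; apply: h_inj; rewrite -!Ds eq_s.
  suff -> : w = [ffun l => stdwedge A (perm s_inj l)].
    by apply: alternating_perm0.
  by apply/ffunP=> i; rewrite !ffunE permE Ds Dw.
by apply: (fA w i k neq_ik); rewrite !Dw eq_h.
Qed.

Theorem wedge_universal W F j (f : {ffun 'I_j -> W} -> F) :
    multilinear f -> alternating f ->
  exists! h : 'Hom(extpow W j, F), forall w, h (wedge w) = f w.
Proof.
move=> fL fA.
pose h0 (x : extpow W j) := \sum_A (x A : K) *: f (stdwedge A).
have h0L : linear h0.
  move=> a x y; rewrite scaler_sumr -big_split /=; apply: eq_bigr => A _.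
  by rewrite !ffunE scalerDl scalerA.
pose h0lin := GRing.isLinear.Build K (extpow W j) F _ h0 h0L.
pose h0' : {linear extpow W j -> F} := HB.pack h0 h0lin.
exists (linfun h0'); split=> [w|h hw].
  apply/eqP; rewrite -subr_eq0; apply/eqP; move: w.
  apply: alternating_eq0 => [w i a u v|w i k neq_ik eq_w|A].
  - rewrite fL wedge_multilinear linearP scalerBr opprD !addrA; congr (_ + _).
    by rewrite -!addrA; congr (_ + _); rewrite addrC.
  - by rewrite (wedge_alternating neq_ik eq_w) linear0 (fA w i k) ?subr0.
  - rewrite lfunE /= /h0 (bigD1 A) //= big1 => [|B neqBA].
      by rewrite wedge_std eqxx scale1r addr0 subrr.
    by rewrite wedge_std eq_sym (negPf neqBA) scale0r.
apply/lfunP=> x; rewrite lfunE {2}[x]extpowE linear_sum.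
by apply: eq_bigr => A _; rewrite linearZ /= hw.
Qed.

Lemma extmap_wedge W W' j (f : 'Hom(W, W')) (w : {ffun 'I_j -> W}) :
  extmap j f (wedge w) = wedge [ffun i => f (w i)].
Proof.
have fL : multilinear (fun w : {ffun 'I_j -> W} => wedge [ffun i => f (w i)]).
  move=> {}w i a u v.
  have fs u' : [ffun k => f (subst_ffun w i u' k)]
             = subst_ffun [ffun k => f (w k)] i (f u').
    by apply/ffunP=> k; rewrite !ffunE (fun_if f).
  by rewrite !fs linearP wedge_multilinear.
have fA : alternating (fun w : {ffun 'I_j -> W} => wedge [ffun i => f (w i)]).
  move=> {}w i k neq_ik eq_w.
  by apply: (wedge_alternating neq_ik); rewrite !ffunE eq_w.
have [h [hw _]] := wedge_universal fL fA.
suff -> : extmap j f = h by rewrite hw.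
apply/lfunP=> x; pose g (x : extpow W j) :=
  \sum_A (x A : K) *: wedge [ffun k => f (stdwedge A k)].
have gh : g =1 h.
  move=> y; rewrite [y in RHS]extpowE linear_sum.
  by apply: eq_bigr => A _; rewrite linearZ /= hw.
have gL : linear g by move=> a y z; rewrite !gh linearP.
pose glin := GRing.isLinear.Build K (extpow W j) (extpow W' j) _ g gL.
pose g' : {linear extpow W j -> extpow W' j} := HB.pack g glin.
by rewrite /extmap (lfunE g').
Qed.

(* The exterior power of a subspace U of W, embedded in that of W by the map  *)
(* induced by the inclusion of U in W; it is an embedding by extmap_vsval_inj.*)
Definition extpowv W (U : {vspace W}) j : {vspace extpow W j} :=
  limg (extmap j (linfun (vsval : subvs_of U -> W))).

Lemma extmap_vsval_inj W (U : {vspace W}) j :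
  injective (extmap j (linfun (vsval : subvs_of U -> W))).
Proof.
apply: (can_inj (g := extmap j (linfun (vsproj U : W -> subvs_of U)))) => x.
rewrite {1}[x]extpowE !linear_sum /= {2}[x]extpowE; apply: eq_bigr => A _.
rewrite !linearZ /= !extmap_wedge; congr (_ *: wedge _).
by apply/ffunP=> k; rewrite !ffunE !lfunE /= vsvalK.
Qed.

End ExteriorPower.

Section CharacteristicHomology.

Variables (K : fieldType) (V : vectType K) (form : {symmetric V}).
Variables (n : nat) (nu : 'I_n -> V).
Implicit Types S T : {set 'I_n}.

Definition nondegenerate_on (U : {vspace V}) : bool :=
  (U :&: orthov form U == 0)%VS.

Definition hyperplane (i : 'I_n) : {vspace V} := orthov form <[nu i]>.

Definition flat S : {vspace V} := (\bigcap_(s in S) hyperplane s)%VS.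

Definition charpoly : {poly int} :=
  \sum_(S : {set 'I_n}) (-1) ^+ #|S| * (1 + 'X) ^+ \dim (flat S).

Definition orthproj (U : {vspace V}) : 'End(V) := daddv_pi U (orthov form U).

Definition cochain_space j : vectType K := {ffun {set 'I_n} -> extpow V j}.

Definition inj_summand j S : 'Hom(extpow V j, cochain_space j) :=
  linfun (fun x : extpow V j =>
    [ffun T => if T == S then x else 0] : cochain_space j).

Definition proj_summand j S : 'Hom(cochain_space j, extpow V j) :=
  linfun (fun c : cochain_space j => c S).

(* The direct sum of the exterior powers of the flat S, for |S| = i. *)
Definition cochain i j : {vspace cochain_space j} :=
  (\sum_(S : {set 'I_n} | #|S| == i) inj_summand j S @: extpowv (flat S) j)%VS.

Definition edge_sign S (r : 'I_n) : K := (-1) ^+ #|[set s in S | (s < r)%N]|.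

(* The orthogonal projection of flat S onto flat (r |: S) is the restriction  *)
(* to flat S of the orthogonal projection of V onto flat (r |: S).            *)
Definition diff j : 'End(cochain_space j) :=
  \sum_(S : {set 'I_n}) \sum_(r | r \notin S)
    edge_sign S r *:
      (inj_summand j (r |: S) \o extmap j (orthproj (flat (r |: S)))
         \o proj_summand j S)%VF.

Definition cocycles i j : {vspace cochain_space j} :=
  (cochain i j :&: lker (diff j))%VS.

Definition coboundaries i j : {vspace cochain_space j} :=
  if i is i'.+1 then (diff j @: cochain i' j)%VS else 0%VS.

(* The quotient of cocycles by coboundaries, realized as a complement of the  *)
(* latter in the former (see coboundaries_cocycles).                          *)
Definition homology i j : {vspace cochain_space j} :=
  (cocycles i j :\: coboundaries i j)%VS.

(* homology i j is zero unless i <= n and j <= \dim {:V}. *)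
Definition euler_char : {poly int} :=
  \sum_(i < n.+1) \sum_(j < (\dim {:V}).+1)
    ((-1) ^+ i * 'X^j) *+ \dim (homology i j).

Lemma addv_orthov (U : {vspace V}) :
  nondegenerate_on U -> (U + orthov form U = fullv)%VS.
Proof.
move=> /eqP Und.
pose m := \dim U; pose f0 (u : V) : {ffun 'I_m -> K^o} :=
  [ffun i : 'I_m => form u (vbasis U)`_i].
have f0L : linear f0.
  by move=> a u v; apply/ffunP=> i; rewrite !ffunE linearPl.
pose f0lin := GRing.isLinear.Build K V {ffun 'I_m -> K^o} _ f0 f0L.
pose f0' : {linear V -> {ffun 'I_m -> K^o}} := HB.pack f0 f0lin.
pose f := linfun f0'.
have kerf : lker f = orthov form U.
  apply/vspaceP=> u; rewrite memv_ker lfunE; apply/eqP/mem_orthovP => [u0 v|uU].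
    move=> /coord_vbasis->; rewrite linear_sumr big1 // => i _.
    by have /ffunP/(_ i) := u0; rewrite !ffunE linearZr => /= ->; rewrite mulr0.
  by apply/ffunP=> i; rewrite !ffunE uU // vbasis_mem // memt_nth.
have fU : (f @: U = fullv)%VS.
  apply/eqP; rewrite eqEdim subvf limg_dim_eq ?kerf //.
  by rewrite dimvf /dim /= card_ord muln1.
apply/eqP; rewrite eqEsubv subvf; apply/subvP=> v _.
have /memv_imgP[u Uu fvu] : f v \in (f @: U)%VS by rewrite fU memvf.
rewrite -[v](subrK u) addrC memv_add // -kerf memv_ker.
by rewrite linearB /= fvu subrr.
Qed.

Lemma orthproj_id U v : nondegenerate_on U -> v \in U -> orthproj U v = v.
Proof. by move=> /eqP Und; apply: daddv_pi_id. Qed.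

Lemma memv_orthproj U v : orthproj U v \in U.
Proof. exact: memv_pi. Qed.

Lemma orthproj_orthov U v : nondegenerate_on U -> v - orthproj U v \in orthov form U.
Proof.
move=> Und; rewrite -{1}[v](daddv_pi_add (eqP Und)) ?addv_orthov ?memvf //.
by rewrite addrC addKr memv_pi.
Qed.

Lemma orthproj_comp U W : (U <= W)%VS ->
  nondegenerate_on U -> nondegenerate_on W ->
  (orthproj U \o orthproj W)%VF = orthproj U.
Proof.
move=> sUW Und Wnd; apply/lfunP=> v; rewrite comp_lfunE.
apply/eqP; rewrite -subr_eq0 -linearB /= -opprB linearN oppr_eq0.
set w := v - _; have Uw : w \in orthov form U.
  have /mem_orthovP ww := orthproj_orthov v Wnd.
  by apply/mem_orthovP=> u /(subvP sUW); apply: ww.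
rewrite -memv0 -(eqP Und) memv_cap memv_orthproj /=.
rewrite -[orthproj U w](subKr w) memvB //; exact: orthproj_orthov.
Qed.

Lemma flatS S T : S \subset T -> (flat T <= flat S)%VS.
Proof.
move=> /subsetP sST; apply/subv_bigcapP=> s Ss.
by rewrite /flat (bigcapv_inf s) // sST.
Qed.

Lemma inj_summandE j S x T : inj_summand j S x T = if T == S then x else 0.
Proof.
pose f (x : extpow V j) : cochain_space j := [ffun T => if T == S then x else 0].
have fL : linear f.
  move=> a u v; apply/ffunP=> T'; rewrite !ffunE.
  by case: eqP => // _; rewrite scaler0 addr0.
pose flin := GRing.isLinear.Build K (extpow V j) (cochain_space j) _ f fL.
pose f' : {linear extpow V j -> cochain_space j} := HB.pack f flin.
by rewrite /inj_summand (lfunE f') /= ffunE.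
Qed.

Lemma proj_summandE j S c : proj_summand j S c = c S.
Proof.
pose f (c : cochain_space j) : extpow V j := c S.
have fL : linear f by move=> a u v; rewrite /f !ffunE.
pose flin := GRing.isLinear.Build K (cochain_space j) (extpow V j) _ f fL.
pose f' : {linear cochain_space j -> extpow V j} := HB.pack f flin.
by rewrite /proj_summand (lfunE f').
Qed.

Lemma diff_inj j S x :
  diff j (inj_summand j S x) =
  \sum_(r | r \notin S) edge_sign S r *:
    inj_summand j (r |: S) (extmap j (orthproj (flat (r |: S))) x).
Proof.
rewrite /diff (bigD1 S) //= add_lfunE !sum_lfunE [X in _ + X]big1 => [|T neqTS].
  rewrite addr0; apply: eq_bigr => r _.
  by rewrite scale_lfunE !comp_lfunE proj_summandE inj_summandE eqxx.
rewrite sum_lfunE big1 // => r _.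
by rewrite scale_lfunE !comp_lfunE proj_summandE inj_summandE (negPf neqTS) !linear0.
Qed.

Lemma edge_signC S r t : r \notin S -> t \notin S -> (r < t)%N ->
  edge_sign S t * edge_sign (t |: S) r = - (edge_sign S r * edge_sign (r |: S) t).
Proof.
move=> rS tS lt_rt; rewrite /edge_sign.
have -> : [set s in t |: S | (s < r)%N] = [set s in S | (s < r)%N].
  apply/setP=> s; rewrite !inE; case: eqP => //= ->.
  by rewrite (negPf tS) ltnNge ltnW.
have -> : [set s in r |: S | (s < t)%N] = r |: [set s in S | (s < t)%N].
  by apply/setP=> s; rewrite !inE; case: eqP => //= ->.
by rewrite cardsU1 inE (negPf rS) /= add1n exprS mulN1r mulrN opprK mulrC.
Qed.

Lemma diff_diff_inj j S x : (forall T, nondegenerate_on (flat T)) ->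
  diff j (diff j (inj_summand j S x)) = 0.
Proof.
move=> nd; rewrite diff_inj linear_sum /=.
pose y r t := inj_summand j (t |: (r |: S))
  (extmap j (orthproj (flat (t |: (r |: S)))) x).
pose G r t := (edge_sign S r * edge_sign (r |: S) t) *: y r t.
have extmap_comp U W : (U <= W)%VS -> nondegenerate_on U -> nondegenerate_on W ->
    extmap j (orthproj U) (extmap j (orthproj W) x) = extmap j (orthproj U) x.
  move=> sUW Und Wnd; rewrite [x]extpowE !linear_sum; apply: eq_bigr => A _.
  rewrite !linearZ /= !extmap_wedge; congr (_ *: wedge _); apply/ffunP=> k.
  by rewrite !ffunE -comp_lfunE orthproj_comp.
transitivity (\sum_(r | r \notin S) \sum_(t | (t \notin S) && (t != r)) G r t).
  apply: eq_bigr => r _; rewrite linearZ /= diff_inj scaler_sumr.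
  apply: eq_big => t; first by rewrite !inE negb_or andbC.
  move=> _; rewrite scalerA /G /y extmap_comp //; exact: flatS (subsetUr _ _).
have Gs r t : r \notin S -> t \notin S -> (r < t)%N -> G t r = - G r t.
  move=> rS tS lt_rt; rewrite /G edge_signC // scaleNr /y.
  by rewrite setUCA.
rewrite (eq_bigr (fun r : 'I_n => \sum_(t | (t \notin S) && (r < t)%N) G r t
   + \sum_(t | (t \notin S) && (t < r)%N) G r t)); last first.
  move=> r _; rewrite (bigID (fun t : 'I_n => (r < t)%N)) /=; congr (_ + _).
    by apply: eq_bigl => t; rewrite -andbA -val_eqE /=; case: ltngtP; rewrite ?andbF.
  by apply: eq_bigl => t; rewrite -andbA -val_eqE /=; case: ltngtP; rewrite ?andbF.
rewrite big_split /= [X in _ + X](exchange_big_dep (fun r : 'I_n => r \notin S)) /=; last first.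
  by move=> r t _ /andP[].
rewrite -big_split big1 //= => r rS.
apply/eqP; rewrite addr_eq0 -sumrN; apply/eqP.
apply: eq_big => [t|t /andP[tS lt_rt]]; first by rewrite rS.
by rewrite (Gs r t) ?opprK.
Qed.

Lemma diff_cochain i j : (diff j @: cochain i j <= cochain i.+1 j)%VS.
Proof.
apply/subvP=> _ /memv_imgP[c /memv_sumP[u uP ->] ->].
rewrite linear_sum /=; apply: memv_suml => S SP.
have /memv_imgP[x _ ->] := uP S SP; rewrite diff_inj.
apply: memv_suml => r rS; apply/memvZ; rewrite memvE.
apply: (sumv_sup (r |: S)); first by rewrite cardsU1 rS add1n (eqP SP).
rewrite -memvE; apply: memv_img; set U := flat _.
rewrite [x]extpowE linear_sum; apply: memv_suml => A _.
rewrite linearZ /= extmap_wedge; apply/memvZ/memv_imgP.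
exists (wedge [ffun k => vsproj U (orthproj U (stdwedge A k))]); rewrite ?memvf //.
rewrite extmap_wedge; congr wedge; apply/ffunP=> k.
by rewrite !ffunE lfunE /= vsprojK ?memv_orthproj.
Qed.

Lemma coboundaries_cocycles i j :
  (forall T, nondegenerate_on (flat T)) -> (coboundaries i j <= cocycles i j)%VS.
Proof.
move=> nd; case: i => [|i] /=; first exact: sub0v.
rewrite subv_cap diff_cochain; apply/subvP=> _ /memv_imgP[c Cc ->].
rewrite memv_ker; move: Cc => /memv_sumP[u uP ->]; rewrite !linear_sum /= big1 // => S SP.
by have /memv_imgP[x _ ->] := uP S SP; rewrite diff_diff_inj.
Qed.

End CharacteristicHomology.

(* Main.v *)
Require Import Defs.
From HB Require Import structures.
From mathcomp Require Import all_boot all_order all_fingroup all_algebra.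

(** The theorem is the Euler-Poincare principle, applied in each exterior
    degree [j] separately.  For fixed [j] the spaces [cochain i j] form a bounded
    complex of finite-dimensional spaces, and rank-nullity splits the dimension
    of a term as

      cochain i = homology i + coboundaries i + coboundaries i.+1

    so that in an alternating sum the coboundaries telescope away
    ([alternating_sum_telescope], [dim_cochain_split]).  The alternating sum of
    the Betti numbers is therefore that of the dimensions of the cochain spaces.
    The latter are explicit: [cochain i j] is the direct sum, over the [S] with
    [i] elements, of the [j]-th exterior powers of the flats of [S], whence
    [dim_cochain], the sum of the binomials ['C(\dim (flat S), j)].  Multiplying by
    ['X^j] and summing over [j] turns each family of binomials into
    [(1 + 'X) ^+ \dim (flat S)], which gives the characteristic polynomial. *)

Import GRing.Theory.
Local Open Scope ring_scope.

Lemma alternating_sum_telescope (R : pzRingType) (c h b : nat -> nat) (N : nat) :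
    b 0 = 0%N -> b N = 0%N -> (forall i, c i = h i + b i + b i.+1)%N ->
  \sum_(i < N) (-1) ^+ i *+ h i = \sum_(i < N) (-1) ^+ i *+ c i :> R.
Proof.
move=> b0 bN cE.
suff partial m : \sum_(i < m) (-1) ^+ i *+ c i
    = \sum_(i < m) (-1) ^+ i *+ h i - (-1) ^+ m *+ b m :> R.
  by rewrite partial bN subr0.
elim: m => [|m IHm]; first by rewrite !big_ord0 b0 subr0.
rewrite !big_ord_recr /= IHm cE !mulrnDr exprS mulN1r mulNrn opprK.
by rewrite -!addrA; congr (_ + _); rewrite addrCA addKr.
Qed.

Lemma expr1D_trunc (R : pzRingType) (x : R) (d m : nat) : (d <= m)%N ->
  (1 + x) ^+ d = \sum_(j < m.+1) x ^+ j *+ 'C(d, j).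
Proof.
move=> le_dm; rewrite addrC exprD1n (big_ord_widen m.+1 (fun j => x ^+ j *+ 'C(d, j))) //.
rewrite big_mkcond; apply: eq_bigr => j _; case: ltnP => // lt_dj.
by rewrite bin_small.
Qed.

Section Dimensions.

Variable K : fieldType.

Lemma dim_extpow (W : vectType K) j : \dim {:extpow W j} = 'C(\dim {:W}, j).
Proof.
rewrite dimvf /dim /= muln1 card_sig -cardsE.
by rewrite card_draws card_ord.
Qed.

Lemma dim_extpowv (W : vectType K) (U : {vspace W}) j :
  \dim (extpowv U j) = 'C(\dim U, j).
Proof.
rewrite /extpowv limg_dim_eq ?dim_extpow ?[\dim {:subvs_of U}]dimvf //.
by apply/eqP; rewrite capfv; apply/lker0P; apply: extmap_vsval_inj.
Qed.

Variables (V : vectType K) (form : {symmetric V}) (n : nat) (nu : 'I_n -> V).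

Lemma inj_summand_inj j (S : {set 'I_n}) : injective (inj_summand V j S).
Proof. by move=> x y /ffunP/(_ S); rewrite !inj_summandE eqxx. Qed.

Lemma dim_cochain i j :
  \dim (cochain form nu i j)
    = \sum_(S : {set 'I_n} | #|S| == i) 'C(\dim (flat form nu S), j).
Proof.
have : directv (\sum_(S : {set 'I_n} | #|S| == i)
                  inj_summand V j S @: extpowv (flat form nu S) j).
  apply/directv_sum_independent => u uP u0 S SP.
  have /memv_imgP[x _ Dx] := uP S SP; rewrite Dx.
  (* The component at S of the vanishing sum sees the S-th summand only. *)
  have := congr1 (fun c : cochain_space V n j => c S) u0.
  rewrite sum_ffunE (bigD1 S) //= big1 ?addr0 => [|T /andP[TP neqTS]].
    by rewrite Dx inj_summandE eqxx ffunE => ->; rewrite linear0.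
  have /memv_imgP[y _ ->] := uP T TP.
  by rewrite inj_summandE eq_sym (negPf neqTS).
move=> /directvP/= dx; rewrite /cochain dx; apply: eq_bigr => S _.
rewrite limg_dim_eq ?dim_extpowv //.
by apply/eqP; rewrite -subv0 -(eqP (introT lker0P (@inj_summand_inj j S))) capvSr.
Qed.

(** Nondegeneracy on the flats makes [diff] square to zero, so that the
    coboundaries are cocycles and [homology] is a quotient of the expected
    dimension. *)
Lemma dim_cochain_split i j :
    (forall S, nondegenerate_on form (flat form nu S)) ->
  (\dim (cochain form nu i j) = \dim (homology form nu i j)
     + \dim (coboundaries form nu i j) + \dim (coboundaries form nu i.+1 j))%N.
Proof.
move=> nd; rewrite -(limg_ker_dim (diff form nu j)); congr (_ + _)%N.
rewrite -/(cocycles form nu i j) addnC -(dimv_cap_compl _ (coboundaries form nu i j)).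
by rewrite (capv_idPr (coboundaries_cocycles _ _ nd)).
Qed.

Lemma coboundaries_top j : coboundaries form nu n.+1 j = 0%VS.
Proof.
apply/eqP; rewrite -subv0; apply: (subv_trans (diff_cochain form nu n j)).
rewrite /cochain big_pred0 // => S; apply: contraTF (max_card S) => /eqP ->.
by rewrite card_ord -ltnNge.
Qed.

End Dimensions.

Theorem proposition2p1 (K : fieldType) (char0 : [pchar K] =i pred0)
    (V : vectType K) (form : {symmetric V}) (form_nd : nondegenerate form)
    (n : nat) (nu : 'I_n -> V)
    (flat_nd : forall S : {set 'I_n}, S != set0 ->
       nondegenerate_on form (flat form nu S)) :
  euler_char form nu = charpoly form nu.
Proof.
have nd S : nondegenerate_on form (flat form nu S).
  have [->|/flat_nd //] := eqVneq S set0.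
  by rewrite /nondegenerate_on /flat big_set0 (eqP form_nd) capv0.
transitivity (\sum_(i < n.+1) \sum_(j < (\dim {:V}).+1)
    ((-1) ^+ i * 'X^j) *+ \dim (cochain form nu i j) : {poly int}).
  rewrite /euler_char exchange_big [RHS]exchange_big; apply: eq_bigr => j _ /=.
  under eq_bigr do rewrite -mulrnAl.
  under [RHS]eq_bigr do rewrite -mulrnAl.
  rewrite -!mulr_suml; congr (_ * _).
  apply: (@alternating_sum_telescope _ (fun i => \dim (cochain form nu i j))
    (fun i => \dim (homology form nu i j))
    (fun i => \dim (coboundaries form nu i j))).
  - exact: dimv0.
  - by rewrite coboundaries_top dimv0.
  - by move=> i; apply: dim_cochain_split.
have card_lt (S : {set 'I_n}) : (#|S| < n.+1)%N.
  by rewrite ltnS -[n in leqRHS]card_ord max_card.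
rewrite /charpoly (partition_big (fun S => Ordinal (card_lt S)) xpredT) //=.
apply: eq_bigr => i _.
under [RHS]eq_bigr => S.
  move=> /eqP/(congr1 val)/= ->.
  rewrite (expr1D_trunc _ 'X _ _ (dimvS (subvf (flat form nu S)))) mulr_sumr.
  over.
rewrite exchange_big /=; apply: eq_bigr => j _.
rewrite dim_cochain -sumrMnr; apply: eq_big => [S|S _]; first by rewrite -val_eqE.
by rewrite mulrnAr.
Qed.
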